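(* Let $0<\alpha<1$. There is a constant $c_\alpha>0$ such that for every $N\in\mathbb{N}$ there is a random smooth volume-preserving diffeomorphism $A$ of $\mathbb{T}^3$, taking two values, each isotopic to the identity, with $$\|\mathbb{E}\nabla A\|_{C^\alpha}=1,\qquad \mathbb{E}\|\nabla A\|_{C^\alpha}\ge c_\alpha N.$$ Moreover, volume preservation places no lower bound on the smallest singular value of a mean: the four matrices $R_0=\mathrm{diag}(1,1,1)$, $R_1=\mathrm{diag}(1,-1,-1)$, $R_2=\mathrm{diag}(-1,1,-1)$, $R_3=\mathrm{diag}(-1,-1,1)$ all lie in $SO(3)$, yet $\tfrac14\sum_{j=0}^3R_j=0$.
   Context: $\mathbb{T}^3=\mathbb{R}^3/\mathbb{Z}^3$; $(\nabla A)_{ij}=\partial_jA_i$; matrix norms are operator norms; $\|\cdot\|_{C^\alpha}$ is the sup norm plus the $\alpha$-Hölder seminorm. *)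

(* Defs.v *)
From HB Require Import structures.
From mathcomp Require Import all_boot all_order all_algebra.
From mathcomp Require Import generic_quotient.
From mathcomp Require Import all_classical all_reals all_analysis.

Set Implicit Arguments.
Unset Strict Implicit.
Unset Printing Implicit Defensive.

Import Order.TTheory GRing.Theory Num.Theory.
Import numFieldNormedType.Exports.

Local Open Scope classical_set_scope.
Local Open Scope ring_scope.
Local Open Scope quotient_scope.

Section torus.
Variable R : realType.

Definition eqmodZ (x y : 'cV[R]_3) : bool :=
  [forall i, x i 0 - y i 0 \is a Num.int].

Lemma eqmodZ_refl : reflexive eqmodZ.
Proof. by move=> x; apply/forallP => i; rewrite subrr rpred0. Qed.

Lemma eqmodZ_sym : symmetric eqmodZ.
Proof.
by move=> x y; apply/eq_forallb => i; rewrite -[LHS]rpredN opprB.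
Qed.

Lemma eqmodZ_trans : transitive eqmodZ.
Proof.
move=> y x z /forallP xy /forallP yz; apply/forallP => i.
by rewrite -(subrKA (y i 0)) rpredD.
Qed.

Canonical eqmodZ_equiv := EquivRel eqmodZ eqmodZ_refl eqmodZ_sym eqmodZ_trans.

Definition torus : Type := {eq_quot eqmodZ}.

Definition torus_pi (x : 'cV[R]_3) : torus := \pi_torus x.

Definition euclid (n : nat) (v : 'cV[R]_n) : R :=
  Num.sqrt (\sum_(i < n) v i 0 ^+ 2).

(* the quotient of the Euclidean distance *)
Definition torus_dist (p q : torus) : R :=
  inf [set r | exists x y, [/\ torus_pi x = p, torus_pi y = q & r = euclid (x - y)]].

Local Notation R3 :=
  (measurableTypeR R * measurableTypeR R * measurableTypeR R)%type.

Definition lebesgue3 : set R3 -> \bar R :=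
  ((lebesgue_measure \x lebesgue_measure) \x lebesgue_measure)%E.

Definition col3 (u : R3) : 'cV[R]_3 :=
  \col_(i < 3) [:: (u.1.1 : R); (u.1.2 : R); (u.2 : R)]`_i.

Definition unit_cube : set R3 :=
  (`[0, 1[%classic `*` `[0, 1[%classic) `*` `[0, 1[%classic.

(* B is Borel in the torus iff its preimage in R^3 is Borel *)
Definition torus_measurable (B : set torus) : Prop :=
  measurable [set u : R3 | B (torus_pi (col3 u))].

(* [0,1)^3 is a fundamental domain of the quotient map *)
Definition torus_volume (B : set torus) : \bar R :=
  lebesgue3 (unit_cube `&` [set u | B (torus_pi (col3 u))]).

(* C^oo: every iterated directional derivative is differentiable everywhere
   (hence continuous) *)
Definition iter_derive (V W : normedModType R) (s : seq V) (f : V -> W) :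
  V -> W := foldr (fun v g => 'D_v g) f s.

Definition smooth (V W : normedModType R) (f : V -> W) : Prop :=
  forall (s : seq V) (x : V), differentiable (iter_derive s f) x.

(* R^3 -> torus is the universal cover and a local diffeomorphism, so the smooth
   self-maps of the torus are those induced by smooth maps of R^3, and the
   lift is unique up to an integer translation *)
Definition is_lift (F : 'cV[R]_3 -> 'cV[R]_3) (A : torus -> torus) : Prop :=
  forall x, torus_pi (F x) = A (torus_pi x).

Definition torus_smooth (A : torus -> torus) : Prop :=
  exists2 F, smooth F & is_lift F A.

Definition torus_diffeo (A : torus -> torus) : Prop :=
  torus_smooth A /\
  exists B, [/\ cancel A B, cancel B A & torus_smooth B].

Definition volume_preserving (A : torus -> torus) : Prop :=
  forall B, torus_measurable B ->
    torus_measurable (A @^-1` B) /\ torus_volume (A @^-1` B) = torus_volume B.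

(* smooth isotopy through diffeomorphisms; smoothness on [0,1] x torus is that of
   the restriction of a smooth map on R x R^3 *)
Definition isotopic_to_id (A : torus -> torus) : Prop :=
  exists (H : R -> torus -> torus) (F : R * 'cV[R]_3 -> 'cV[R]_3),
    [/\ smooth F,
        forall t : R, 0 <= t <= 1 ->
          is_lift (fun x => F (t, x)) (H t) /\ torus_diffeo (H t),
        H 0 = id &
        H 1 = A].

(* meaningful for smooth A only; does not depend on the lift nor on the
   representative of p *)
Definition smooth_lift (A : torus -> torus) : 'cV[R]_3 -> 'cV[R]_3 :=
  xget (idfun : 'cV[R]_3 -> 'cV[R]_3) [set F | smooth F /\ is_lift F A].

Definition grad (A : torus -> torus) (p : torus) : 'M[R]_3 :=
  \matrix_(i < 3, j < 3) ('D_(delta_mx j 0) (smooth_lift A) (repr p)) i 0.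

Definition opnorm (n : nat) (M : 'M[R]_n) : R :=
  sup [set euclid (M *m v) | v in [set v : 'cV[R]_n | euclid v <= 1]].

Definition sup_norm (f : torus -> 'M[R]_3) : \bar R :=
  ereal_sup [set (opnorm (f p))%:E | p in [set: torus]].

Definition holder_seminorm (a : R) (f : torus -> 'M[R]_3) : \bar R :=
  ereal_sup [set e | exists p q, p <> q /\
    e = (opnorm (f p - f q) / torus_dist p q `^ a)%:E].

Definition Calpha_norm (a : R) (f : torus -> 'M[R]_3) : \bar R :=
  (sup_norm f + holder_seminorm a f)%E.

(* a random element with exactly two distinct values, each of positive
   probability *)
Definition two_valued d (W : measurableType d) (P : probability W R) (X : Type)
    (A : W -> X) : Prop :=
  exists B1 B2 : X,
    [/\ B1 <> B2,
        range A = [set B1; B2],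
        measurable (A @^-1` [set B1]) /\ measurable (A @^-1` [set B2]) &
        (0 < P (A @^-1` [set B1]))%E /\ (0 < P (A @^-1` [set B2]))%E].

Definition mean_mx d (W : measurableType d) (P : probability W R) (n : nat)
    (M : W -> 'M[R]_n) : 'M[R]_n :=
  \matrix_(i, j) fine ('E_P[fun w => M w i j])%E.

Definition in_SO (n : nat) (M : 'M[R]_n) : Prop :=
  M^T *m M = 1%:M /\ \det M = 1.

Definition smallest_singular_value (n : nat) (M : 'M[R]_n) : R :=
  inf [set s | 0 <= s /\ eigenvalue (M^T *m M) (s ^+ 2)].

Definition average_mx (m n : nat) (M : 'I_m -> 'M[R]_n) : 'M[R]_n :=
  m%:R^-1 *: \sum_(j < m) M j.

Definition diag3 (a b c : R) : 'M[R]_3 := diag_mx (\row_(k < 3) [:: a; b; c]`_k).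

Definition Rmx (j : 'I_4) : 'M[R]_3 :=
  [:: diag3 1 1 1; diag3 1 (-1) (-1); diag3 (-1) 1 (-1); diag3 (-1) (-1) 1]`_j.

End torus.

(* Main.v *)
(** Take the shears A_a(x) = x + a sin(2 pi x_1) e_0 (coordinates numbered from
    0) with a = N + 1/4, and choose between A_a and A_{-a} with probability 1/2.
    The gradient of A_a is 1 + 2 pi a cos(2 pi x_1) E_01, so the oscillating
    parts cancel in the mean, which is the identity matrix, while each gradient
    has an entry of size 2 pi a at the origin. Volume is preserved because a
    shear translates each circle in the direction e_0. The inverse of A_a is A_{-a}, and
    t |-> A_{ta} is an isotopy to the identity. *)
From HB Require Import structures.
Require Import Defs.
From mathcomp Require Import all_boot all_order all_algebra.
From mathcomp Require Import generic_quotient.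
From mathcomp Require Import all_classical all_reals all_analysis.
From mathcomp Require Import measurable_realfun ring lra.

Set Implicit Arguments.
Unset Strict Implicit.
Unset Printing Implicit Defensive.

Import Order.TTheory GRing.Theory Num.Theory.
Import numFieldNormedType.Exports.

Local Open Scope classical_set_scope.
Local Open Scope ring_scope.

(** * Smoothness of maps that are linear plus constant plus trigonometric *)

Section smooth_waves.
Variable R : realType.

Lemma is_diff_linear (V W : normedModType R) (f : V -> W) (x : V) :
  linear f -> continuous f -> is_diff x f f.
Proof.
move=> flin fcont.
pose fM := GRing.isLinear.Build _ _ _ _ _ flin.
pose fL : {linear V -> W} := HB.pack f fM.
by apply: DiffDef; [exact: (linear_differentiable (f := fL))|
  exact: (diff_lin (f := fL))].
Qed.

Lemma is_diff_sin (x : R) : is_diff x (@sin R) (fun h => h * cos x).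
Proof.
apply: DiffDef; first exact/derivable1_diffP/derivable_sin.
rewrite deriv1E; last exact: derivable_sin.
by rewrite derive1E derive_val.
Qed.

Lemma is_diff_cos (x : R) : is_diff x (@cos R) (fun h => h * - sin x).
Proof.
apply: DiffDef; first exact/derivable1_diffP/derivable_cos.
rewrite deriv1E; last exact: derivable_cos.
by rewrite derive1E derive_val.
Qed.

Variables (V W : normedModType R) (l : V -> W) (tau lam : V -> R) (e : W).
Hypothesis dl : forall x, is_diff x l l.
Hypothesis dtau : forall x, is_diff x tau tau.
Hypothesis dlam : forall x, is_diff x lam lam.

(* A family stable under directional derivatives; [tau] is the time variable of
   the isotopy. *)
Definition wave (k : R) (c : W) (p p' q q' : R) (x : V) : W :=
  k *: l x + c + ((p + p' * tau x) * sin (lam x) +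
                  (q + q' * tau x) * cos (lam x)) *: e.

(** The product and chain rules turn the linear part into a constant and mix the amplitudes of sine
    and cosine. The new coefficients depend on the direction [v] but not on the point [x], so the
    derivative can be differentiated again in the same form. *)
Lemma is_diff_wave k c p p' q q' x :
  is_diff x (wave k c p p' q q')
    (fun v => wave 0 (k *: l v) (p' * tau v - q * lam v) (- (q' * lam v))
       (q' * tau v + p * lam v) (p' * lam v) x).
Proof.
have dsin : is_diff x (sin \o lam) ((fun h => h * cos (lam x)) \o lam).
  by apply: is_diff_comp; exact: is_diff_sin.
have dcos : is_diff x (cos \o lam) ((fun h => h * - sin (lam x)) \o lam).
  by apply: is_diff_comp; exact: is_diff_cos.
have dcst (c0 : R) : is_diff x (cst c0 : V -> R) (cst 0) by exact: is_diff_cst.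
have damp := is_diffD
  (is_diffM (is_diffD (dcst p) (is_diffM (dcst p') (dtau x))) dsin)
  (is_diffM (is_diffD (dcst q) (is_diffM (dcst q') (dtau x))) dcos).
have dampe := is_diff_comp damp (is_diff_scalel _ e).
have dall := is_diffD (is_diffD (is_diffZ k (dl x)) (is_diff_cst c x)) dampe.
apply: (is_diff_eq dall); apply/funext => v.
rewrite /wave !fctE /= !scale0r !add0r addr0; congr (_ + _ *: _).
rewrite /GRing.scale /=; ring.
Qed.

Lemma smooth_wave k c p p' q q' : smooth (wave k c p p' q q').
Proof.
move=> s x.
(* Only the shape of an iterated derivative matters, so its coefficients are left existential for
   the induction on the directions. *)
suff [k' [c' [r [r' [t [t' ->]]]]]] : exists k' c' r r' t t',
    iter_derive s (wave k c p p' q q') = wave k' c' r r' t t'.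
  by have [] := is_diff_wave k' c' r r' t t' x.
elim: s => [|v s [k' [c' [r [r' [t [t' /= ->]]]]]]]; first by do 6 eexists.
do 6 eexists; apply/funext => y.
have dw := is_diff_wave k' c' r r' t t' y.
by rewrite deriveE ?diff_val.
Qed.

End smooth_waves.

(** * Shears of R^3 and the diffeomorphisms they induce on the torus *)

Section torus_shear.
Variable R : realType.
Implicit Types (x y : 'cV[R]_3) (p : torus R) (a b t : R).

Lemma torus_piP x y :
  reflect (forall i, x i 0 - y i 0 \is a Num.int) (torus_pi x == torus_pi y).
Proof.
apply: (iffP idP).
  by move=> /eqP /eqmodP /forallP.
by move=> xy; apply/eqP/eqmodP/forallP.
Qed.

Lemma torus_pi_repr p : torus_pi (repr p) = p.
Proof. exact: reprK. Qed.

Lemma repr_torus_pi x i : repr (torus_pi x) i 0 - x i 0 \is a Num.int.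
Proof.
by move: i; apply/torus_piP; rewrite torus_pi_repr.
Qed.

Lemma sin_cos_turns (k : int) a :
  sin (a + pi *+ 2 * k%:~R) = sin a /\ cos (a + pi *+ 2 * k%:~R) = cos a.
Proof.
have nat_turns (n : nat) (c : R) :
    sin (c + pi *+ 2 * n%:R) = sin c /\ cos (c + pi *+ 2 * n%:R) = cos c.
  by rewrite mulr_natr; split; apply: periodicn; [exact: sinD2pi|exact: cosD2pi].
case: (intP k) => [|n|n]; first by rewrite mulr0 addr0.
- exact: nat_turns.
(* Negative turns: the natural case is applied at the point already turned backwards. *)
- have [] := nat_turns n.+1 (a + pi *+ 2 * (- n.+1%:Z)%:~R).
  by rewrite mulrNz mulrN subrK.
Qed.

Definition phase x : R := pi *+ 2 * x 1 0.

Lemma phase_int x y : x 1 0 - y 1 0 \is a Num.int ->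
  sin (phase x) = sin (phase y) /\ cos (phase x) = cos (phase y).
Proof.
move=> /intrP [k xy]; have -> : phase x = phase y + pi *+ 2 * k%:~R.
  by rewrite -xy /phase -mulrDr addrC subrK.
exact: sin_cos_turns.
Qed.

Definition shear a x : 'cV[R]_3 := x + (a * sin (phase x)) *: delta_mx 0 0.

Lemma shear0 x : shear 0 x = x.
Proof. by rewrite /shear mul0r scale0r addr0. Qed.

Lemma shear_coord a x i : (i != 0) -> shear a x i 0 = x i 0.
Proof. by move=> /negbTE i0; rewrite !mxE i0 mulr0 addr0. Qed.

Lemma phase_shear a x : phase (shear a x) = phase x.
Proof. by rewrite /phase shear_coord. Qed.

Lemma shearD a b x : shear a (shear b x) = shear (a + b) x.
Proof.
by rewrite {1}/shear phase_shear /shear -addrA -scalerDl -mulrDl [b + a]addrC.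
Qed.

(** Evaluating at the canonical representative makes this a function at once; [shear_is_lift] shows
    that any other representative gives the same point. *)
Definition torus_shear a p : torus R := torus_pi (shear a (repr p)).

(** The displacement depends on [x] only through [sin (phase x)], which integer translations leave
    fixed, so congruent points stay congruent. *)
Lemma shear_is_lift a : is_lift (shear a) (torus_shear a).
Proof.
move=> x; apply/eqP/torus_piP => i.
have xr j : x j 0 - repr (torus_pi x) j 0 \is a Num.int.
  by rewrite -rpredN opprB repr_torus_pi.
by rewrite !mxE (phase_int (xr 1)).1 opprD addrACA subrr addr0.
Qed.

Lemma torus_shear0 : torus_shear 0 = id.
Proof. by apply/funext => p; rewrite /torus_shear shear0 torus_pi_repr. Qed.

Lemma torus_shearK a : cancel (torus_shear a) (torus_shear (- a)).
Proof.
move=> p; rewrite -[p]torus_pi_repr -!shear_is_lift shearD addNr.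
by rewrite shear0.
Qed.

Lemma is_diff_phase (V : normedModType R) (f df : V -> 'cV[R]_3) (x : V) :
  is_diff x f df -> is_diff x (phase \o f) (phase \o df).
Proof.
move=> ?; apply: is_diff_comp; apply: is_diff_linear.
  by move=> k u v; rewrite /phase !mxE /GRing.scale /=; ring.
move=> y; have cy : {for y, continuous (fun z : 'cV[R]_3 => z 1 0 : R)}.
  exact/differentiable_continuous/differentiable_coord.
exact: (continuousM (@cst_continuous _ _ (pi *+ 2) y) cy).
Qed.

Lemma shear_wave a :
  shear a = wave id (fun=> 0) phase (delta_mx 0 0) 1 0 a 0 0 0.
Proof.
apply/funext => x.
by rewrite /wave scale1r addr0 !mulr0 !addr0 mul0r addr0.
Qed.

Lemma smooth_shear a : smooth (shear a).
Proof.
rewrite shear_wave.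
have d1 (x : 'cV[R]_3) : is_diff x id id by exact: is_diff_id.
have d2 (x : 'cV[R]_3) : is_diff x (fun=> 0 : R) (fun=> 0) by exact: is_diff_cst.
exact: (smooth_wave (delta_mx 0 0) d1 d2 (fun x => is_diff_phase (d1 x))).
Qed.

(** The time [z.1] serves as [tau]: with [p = 0] and [p' = a] the sine has amplitude [a * z.1]. *)
Lemma smooth_shear_homotopy a :
  smooth (fun z : R * 'cV[R]_3 => shear (z.1 * a) z.2).
Proof.
have -> : (fun z : R * 'cV[R]_3 => shear (z.1 * a) z.2) =
    wave snd fst (phase \o snd) (delta_mx 0 0) 1 0 0 a 0 0.
  apply/funext => x.
  by rewrite /wave scale1r addr0 !add0r !mul0r addr0 [a * _]mulrC.
have d1 (x : R * 'cV[R]_3) : is_diff x fst fst.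
  by apply: is_diff_linear => // y; exact: cvg_fst.
have d2 (x : R * 'cV[R]_3) : is_diff x snd snd.
  by apply: is_diff_linear => // y; exact: cvg_snd.
exact: (smooth_wave (delta_mx 0 0) d2 d1 (fun z => is_diff_phase (d2 z))).
Qed.

Lemma torus_shear_diffeo a : torus_diffeo (torus_shear a).
Proof.
split; first by exists (shear a); [exact: smooth_shear|exact: shear_is_lift].
exists (torus_shear (- a)); split; first exact: torus_shearK.
  by rewrite -{2}(opprK a); exact: torus_shearK.
by exists (shear (- a)); [exact: smooth_shear|exact: shear_is_lift].
Qed.

Lemma torus_shear_isotopic a : isotopic_to_id (torus_shear a).
Proof.
exists (fun t => torus_shear (t * a)), (fun z => shear (z.1 * a) z.2); split.
- exact: smooth_shear_homotopy.
- by move=> t _; split; [move=> x; exact: shear_is_lift|exact: torus_shear_diffeo].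
- by rewrite mul0r torus_shear0.
- by rewrite mul1r.
Qed.

End torus_shear.

(** * Independence of the gradient from the lift, and the gradient of a shear *)

Section gradient.
Variable R : realType.
Implicit Types (x v : 'cV[R]_3) (p : torus R) (a : R).

(** One explicit smooth lift guarantees that [xget] picks a genuine lift and not its default
    [idfun]. *)
Lemma smooth_liftP (A : torus R -> torus R) F : smooth F -> is_lift F A ->
  smooth (smooth_lift A) /\ is_lift (smooth_lift A) A.
Proof.
by move=> sF lF; rewrite /smooth_lift; case: xgetP => [G _ //|/(_ F) []].
Qed.

Lemma int_norm_lt1 (r : R) : r \is a Num.int -> `|r| < 1 -> r = 0.
Proof.
by move=> rint; apply: contraTeq; rewrite -leNgt => r0; exact: norm_intr_ge1.
Qed.

(* Two continuous lifts differ by a continuous function with integer values. *)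
Lemma lift_unique_near (A : torus R -> torus R) F G x : is_lift F A ->
  is_lift G A -> continuous F -> continuous G ->
  \forall y \near x, F y = G y + (F x - G x).
Proof.
move=> lF lG cF cG.
have int_diff y i : F y i 0 - G y i 0 \is a Num.int.
  by move: i; apply/torus_piP; rewrite lF lG.
suff near_i : \forall y \near x, forall i : 'I_3,
    `|(F y i 0 - G y i 0) - (F x i 0 - G x i 0)| < 1.
  apply: filterS near_i => y near_y; apply/colP => i; rewrite !mxE.
  have := int_norm_lt1 (rpredB (int_diff y i) (int_diff x i)) (near_y i).
  by move/eqP; rewrite subr_eq0 => /eqP <-; rewrite addrC subrK.
apply: (@filter_forall _ 'I_3 (fun i => [set y |
    `|(F y i 0 - G y i 0) - (F x i 0 - G x i 0)| < 1]) (nbhs x)) => i.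
have cD : {for x, continuous (fun y => F y i 0 - G y i 0 : R)}.
  have cc (H : 'cV[R]_3 -> 'cV[R]_3) : continuous H ->
      {for x, continuous (fun y => H y i 0 : R)}.
    move=> cH; apply: (@continuous_comp _ _ _ H (fun z : 'cV[R]_3 => z i 0 : R)).
      exact: cH.
    exact/differentiable_continuous/differentiable_coord.
  exact: (continuousB (cc _ cF) (cc _ cG)).
have /cvgrPdist_lt /(_ 1 ltr01) := cD.
by apply: filterS => y; rewrite distrC.
Qed.

(** Near [x] the two lifts differ by a constant. Hence [grad], defined through an unspecified lift,
    can be computed with an explicit one. *)
Lemma derive_lift_unique (A : torus R -> torus R) F G x v :
  smooth F -> smooth G -> is_lift F A -> is_lift G A -> 'D_v F x = 'D_v G x.
Proof.
move=> sF sG lF lG.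
have dF y : differentiable F y by exact: (sF [::] y).
have dG y : differentiable G y by exact: (sG [::] y).
have cF : continuous F by move=> y; exact: differentiable_continuous.
have cG : continuous G by move=> y; exact: differentiable_continuous.
rewrite (near_eq_derive v (lift_unique_near x lF lG cF cG)).
rewrite (@deriveD _ _ _ G (cst (F x - G x))).
- by rewrite derive_cst addr0.
- exact: diff_derivable.
- exact: derivable_cst.
Qed.

Lemma derive_shear a x v :
  'D_v (shear a) x = v + (a * phase v * cos (phase x)) *: delta_mx 0 0.
Proof.
have d1 (y : 'cV[R]_3) : is_diff y id id by exact: is_diff_id.
have d2 (y : 'cV[R]_3) : is_diff y (fun=> 0 : R) (fun=> 0) by exact: is_diff_cst.
rewrite shear_wave.
have dw := is_diff_wave (delta_mx 0 0) d1 d2 (fun y => is_diff_phase (d1 y))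
  1 0 a 0 0 0 x.
rewrite deriveE ?diff_val /wave; last by case: dw.
rewrite scale0r add0r scale1r /=; congr (_ + _ *: _); ring.
Qed.

Lemma grad_shear a p : grad (torus_shear a) p =
  1%:M + (a * (pi *+ 2) * cos (phase (repr p))) *: delta_mx 0 1.
Proof.
have [sl ll] := smooth_liftP (@smooth_shear _ a) (@shear_is_lift _ a).
apply/matrixP => i j; rewrite !mxE.
rewrite (derive_lift_unique _ _ sl (@smooth_shear _ a) ll (@shear_is_lift _ a)).
rewrite derive_shear /phase !mxE !andbT /=.
by rewrite [1 == j]eq_sym; case: (i == 0); case: (j == 1);
  rewrite /= ?(mulr1, mulr0, mul0r).
Qed.

End gradient.

(** * Operator norms and elementary bounds on the Hölder norm *)

Section operator_norm.
Variable R : realType.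
Implicit Types n : nat.

Lemma euclid0 n : euclid (0 : 'cV[R]_n) = 0.
Proof.
by rewrite /euclid big1 ?sqrtr0// => i _; rewrite mxE expr0n.
Qed.

Lemma coord_le_euclid n (v : 'cV[R]_n) i : `|v i 0| <= euclid v.
Proof.
rewrite -sqrtr_sqr ler_sqrt ?sumr_ge0// => [|j _]; last exact: sqr_ge0.
by rewrite (bigD1 i)//= lerDl sumr_ge0// => j _; exact: sqr_ge0.
Qed.

Lemma euclid_delta n (j : 'I_n) : euclid (delta_mx j 0 : 'cV[R]_n) = 1.
Proof.
rewrite /euclid (bigD1 j)//= big1 => [|k /negbTE kj].
  by rewrite mxE !eqxx expr1n addr0 sqrtr1.
by rewrite mxE kj expr0n.
Qed.

(** The set whose supremum is [opnorm M]; a real [sup] is informative only once this set is known to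
    be nonempty and bounded above. *)
Definition opnorm_values n (M : 'M[R]_n) : set R :=
  [set euclid (M *m v) | v in [set v : 'cV[R]_n | euclid v <= 1]].

Lemma opnorm_values0 n (M : 'M[R]_n) : opnorm_values M 0.
Proof. by exists 0; rewrite /= ?mulmx0 euclid0. Qed.

Lemma opnorm_values_bounded n (M : 'M[R]_n) : has_ubound (opnorm_values M).
Proof.
(* Coordinates of [v] have modulus at most 1, so each coordinate of [M *m v] is bounded by the sum
   of the moduli in its row. *)
exists (Num.sqrt (\sum_(i < n) (\sum_(j < n) `|M i j|) ^+ 2)) => _ [v /= v1 <-].
rewrite ler_sqrt; last by apply: sumr_ge0 => i _; exact: sqr_ge0.
apply: ler_sum => i _; rewrite -[leLHS]real_normK ?num_real//.
rewrite lerXn2r ?nnegrE ?sumr_ge0// mxE.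
apply: le_trans (ler_norm_sum _ _ _) _; apply: ler_sum => j _.
by rewrite normrM ler_piMr// (le_trans (coord_le_euclid v j)).
Qed.

Lemma opnorm_ge0 n (M : 'M[R]_n) : 0 <= opnorm M.
Proof.
by apply: ub_le_sup; [exact: opnorm_values_bounded|exact: opnorm_values0].
Qed.

Lemma entry_le_opnorm n (M : 'M[R]_n) i j : `|M i j| <= opnorm M.
Proof.
have /le_trans -> // : `|M i j| <= euclid (M *m delta_mx j 0).
  by rewrite -colE; have := coord_le_euclid (col j M) i; rewrite mxE.
apply: ub_le_sup; first exact: opnorm_values_bounded.
by exists (delta_mx j 0) => //=; rewrite euclid_delta.
Qed.

Lemma opnorm0 n : opnorm (0 : 'M[R]_n) = 0.
Proof.
rewrite /opnorm [X in sup X](_ : _ = [set 0]) ?sup1//.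
apply/seteqP; split => [_ [v _ <-]|_ ->]; first by rewrite mul0mx euclid0.
exact: opnorm_values0.
Qed.

Lemma opnorm1 n : opnorm (1%:M : 'M[R]_n.+1) = 1.
Proof.
apply/eqP; rewrite eq_le; apply/andP; split.
  apply: ge_sup; first by exists 0; exact: opnorm_values0.
  by move=> _ [v v1 <-]; rewrite mul1mx.
have := entry_le_opnorm (1%:M : 'M[R]_n.+1) 0 0.
by rewrite mxE eqxx normr1.
Qed.

(** Keeps the set of Hölder quotients nonempty: the supremum of the empty set in the extended reals
    would be [-oo]. *)
Lemma torus_nontrivial : exists p q : torus R, p <> q.
Proof.
exists (torus_pi 0), (torus_pi (const_mx 2^-1)) => /eqP/torus_piP/(_ 0).
rewrite !mxE sub0r rpredN => /int_norm_lt1.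
rewrite ger0_norm ?invr_ge0// invf_lt1 ?ltr0n// ltr1n => /(_ isT)/eqP.
by rewrite invr_eq0 pnatr_eq0.
Qed.

Lemma holder_seminorm_ge0 (alpha : R) f : (0 <= holder_seminorm alpha f)%E.
Proof.
have [p [q pq]] := torus_nontrivial.
apply: (@le_trans _ _ (opnorm (f p - f q) / torus_dist p q `^ alpha)%:E).
  by rewrite lee_fin divr_ge0 ?opnorm_ge0 ?powR_ge0.
by apply: ereal_sup_ubound; exists p, q.
Qed.

(** An entry is bounded by the operator norm at [p], hence by the sup norm, and the seminorm only
    adds a nonnegative term. A single large entry thus makes the whole norm large. *)
Lemma entry_le_Calpha_norm (alpha : R) (f : torus R -> 'M[R]_3) (p : torus R) i j :
  (`|f p i j|%:E <= Calpha_norm alpha f)%E.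
Proof.
apply: (@le_trans _ _ (opnorm (f p))%:E); first by rewrite lee_fin entry_le_opnorm.
apply: (@le_trans _ _ (sup_norm f)); last by rewrite leeDl// holder_seminorm_ge0.
by apply: ereal_sup_ubound; exists p.
Qed.

Lemma Calpha_norm_ge0 (alpha : R) f : (0 <= Calpha_norm alpha f)%E.
Proof.
by apply: le_trans (entry_le_Calpha_norm alpha f (torus_pi 0) 0 0); rewrite lee_fin.
Qed.

Lemma Calpha_norm_id (alpha : R) : Calpha_norm alpha (fun=> 1%:M) = 1%E.
Proof.
rewrite /Calpha_norm.
have -> : sup_norm (fun=> 1%:M : 'M[R]_3) = 1%E.
  rewrite /sup_norm opnorm1 [X in ereal_sup X](_ : _ = [set 1%E]) ?ereal_sup1//.
  apply/seteqP; split => [_ [p _ <-] //|_ ->].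
  by exists (torus_pi 0).
suff -> : holder_seminorm alpha (fun=> 1%:M : 'M[R]_3) = 0%E by rewrite adde0.
rewrite /holder_seminorm subrr opnorm0 [X in ereal_sup X](_ : _ = [set 0%E]).
  by rewrite ereal_sup1.
apply/seteqP; split => [_ [p [q [_ ->]]]|_ ->]; first by rewrite mul0r.
by have [p [q pq]] := torus_nontrivial; exists p, q; rewrite mul0r.
Qed.

End operator_norm.

(** * Lebesgue measure: order of integration and translations of periodic sets *)

(** Both iterated integrals agree on measurable rectangles, and sigma-finiteness makes the product
    measure unique. *)
Lemma product_measure12 d1 d2 (T1 : measurableType d1) (T2 : measurableType d2)
    (R : realType) (m1 : {sigma_finite_measure set T1 -> \bar R})
    (m2 : {sigma_finite_measure set T2 -> \bar R}) (X : set (T1 * T2)) :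
  measurable X -> (m1 \x m2)%E X = (m1 \x^ m2)%E X.
Proof.
by apply: product_measure_unique => A B mA mB; exact: product_measure2E.
Qed.

Section volume.
Variable R : realType.
Local Notation mu := (@lebesgue_measure R).
Local Notation RR := (measurableTypeR R).
Local Notation R3 := (RR * RR * RR)%type.

Definition translation (c : R) : RR -> RR := fun x => x + c : R.

Lemma measurable_translation (c : R) : measurable_fun [set: RR] (translation c).
Proof.
by apply: (@measurable_funD _ RR R _ id (cst c)); [exact: measurable_id|
  exact: measurable_cst].
Qed.

(** The pushforward under a translation gives half-open intervals their length, which characterizes
    Lebesgue measure. *)
Lemma lebesgue_measure_translation (c : R) (A : set RR) : measurable A ->
  mu (translation c @^-1` A) = mu A.
Proof.
move=> mA; rewrite -/(pushforward mu (translation c) A).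
apply/esym/lebesgue_measure_unique => //=; first exact: measurable_translation.
move=> mt _ [[a b]] _ <-; rewrite /pushforward /=.
have -> : translation c @^-1` `]a, b] = `]a - c, b - c]%classic.
  by apply/seteqP; split => x; rewrite /= !in_itv /= lerBrDr ltrBlDr.
rewrite !lebesgue_measure_itv /= !lte_fin ltrD2r.
case: ifP => // _; rewrite -!EFinD; congr (_%:E); ring.
Qed.

(** By periodicity [c] may be replaced by its fractional part [f]. The cell then becomes [[f, 1 +
    f[], whose part beyond 1 is moved back by 1 onto [[0, f[]. *)
Lemma lebesgue_cell_translation (T : set RR) (c : R) : measurable T ->
  (forall (k : int) x, T (x + k%:~R) <-> T x) ->
  mu (`[0, 1[%classic `&` translation c @^-1` T) = mu (`[0, 1[%classic `&` T).
Proof.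
move=> mT perT; pose f := c - (Num.floor c)%:~R.
have f0 : 0 <= f by rewrite subr_ge0 floor_le_tmp.
have f1 : f < 1 by rewrite ltrBlDr addrC -intrD1 floorD1_gt.
have -> : translation c @^-1` T = translation f @^-1` T.
  apply/seteqP; split => x; rewrite /= /translation.
    by move/(perT (- Num.floor c)); rewrite mulrNz addrA.
  by move=> Tx; apply/(perT (- Num.floor c)); rewrite mulrNz -addrA.
have -> : `[0, 1[%classic `&` translation f @^-1` T =
    translation f @^-1` (`[f, 1 + f[%classic `&` T).
  by apply/seteqP; split => x [/= xI Tx]; split => //; move: xI;
    rewrite !in_itv /= /translation lerDr ltrD2r.
have mI (b d : R) : measurable (`[b, d[%classic `&` T : set RR) by exact: measurableI.
rewrite lebesgue_measure_translation; last exact: mI.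
have split_cell (b d e : R) : b <= d -> d <= e ->
    mu (`[b, e[%classic `&` T) =
    (mu (`[b, d[%classic `&` T) + mu (`[d, e[%classic `&` T))%E.
  move=> bd de; rewrite -measureU.
  - by rewrite -setIUl -itv_bndbnd_setU ?bnd_simp.
  - exact: mI.
  - exact: mI.
  - rewrite -subset0 => x [[/= + _] [/= + _]]; rewrite !in_itv /=.
    by move=> /andP[_ xd] /andP[dx _]; move: (lt_le_trans xd dx); rewrite ltxx.
(* Both sides share the piece over [[f, 1[]; it remains to compare [[1, 1 + f[] with [[0, f[]. *)
rewrite (split_cell f 1) ?(ltW f1) ?lerDl// (split_cell 0 f) ?(ltW f1)// [RHS]addeC.
congr (_ + _)%E; rewrite -(lebesgue_measure_translation (-1) (mI 0 f)).
congr (mu _); apply/seteqP; split => x [/= + Tx]; rewrite !in_itv /= => xI.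
  split; first by move: xI; rewrite /translation; lra.
  by apply/(perT 1 (x - 1)).1; rewrite subrK.
split; first by move: xI; rewrite /translation; lra.
by have := (perT 1 (x - 1)).2 Tx; rewrite subrK.
Qed.

(* The canonical sigma-finite structure that the library attaches to [m1 \x m2]
   only covers products of subprobabilities, hence the explicit packing in
   [lebesgue3E]. *)
Lemma sigma_finite_lebesgue2 : sigma_finite setT (mu \x mu)%E.
Proof.
pose I (n : nat) : set RR := `]- n%:R, n%:R[%classic.
exists (fun n => I n `*` I n).
  apply/esym/seteqP; split => // -[x y] _.
  have bound (n : nat) (z : R) : `|z| <= n%:R -> I n.+1 z.
    by rewrite /I /= in_itv /= -ltr_norml => /le_lt_trans; apply; rewrite ltr_nat.
  exists (Num.bound `|x| + Num.bound `|y|).+1 => //; split; apply: bound;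
    rewrite natrD ltW// (lt_le_trans (archi_boundP _)) ?normr_ge0//=
      ?lerDl ?lerDr ?ler0n//.
move=> n; have mI : measurable (I n) by exact: measurable_itv.
have muI : (mu (I n) < +oo)%E.
  by rewrite /I lebesgue_measure_itv /=; case: ifP => _; rewrite -?EFinD ltry.
split; first exact: measurableX.
by rewrite product_measure1E// lte_mul_pinfty// ge0_fin_numE ?measure_ge0.
Qed.

(* The first coordinate is integrated innermost: on each such line a shear is a
   translation. *)
Lemma lebesgue3E (X : set R3) : measurable X ->
  lebesgue3 X =
  (\int[mu]_z \int[mu]_y mu (ysection (ysection X z) y))%E.
Proof.
move=> mX.
pose sf := Measure_isSigmaFinite.Build _ _ _ (mu \x mu)%E sigma_finite_lebesgue2.
pose mumu : {sigma_finite_measure set (RR * RR)%type -> \bar R} :=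
  HB.pack (mu \x mu)%E sf.
have XE : (mumu \x mu)%E X =
    (\int[mu]_z \int[mu]_y mu (ysection (ysection X z) y))%E.
  rewrite (product_measure12 mumu mu mX); apply: eq_integral => z _.
  exact: (product_measure12 mu mu (measurable_ysection z mX)).
exact: XE.
Qed.

End volume.

(** * Shears preserve the volume of the torus *)

Section shear_volume.
Variable R : realType.
Local Notation mu := (@lebesgue_measure R).
Local Notation RR := (measurableTypeR R).
Local Notation R3 := (RR * RR * RR)%type.

Definition shear3 (a : R) (u : R3) : R3 :=
  ((translation (a * sin (pi *+ 2 * (u.1.2 : R))) u.1.1, u.1.2), u.2).

Lemma col3_shear3 a u : col3 (shear3 a u) = shear a (col3 u).
Proof.
apply/colP => i; rewrite !mxE /phase mxE /=.
by case: i => -[|[|[|//]]] /= _; rewrite ?mulr1 ?mulr0 ?addr0.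
Qed.

Lemma measurable_shear3 a : measurable_fun [set: R3] (shear3 a).
Proof.
have m11 : measurable_fun [set: R3] (fun u => u.1.1).
  by apply: measurableT_comp measurable_fst; exact: measurable_fst.
have m12 : measurable_fun [set: R3] (fun u => u.1.2).
  by apply: measurableT_comp measurable_fst; exact: measurable_snd.
have msin : measurable_fun [set: RR]
    (fun y : RR => a * sin (pi *+ 2 * (y : R)) : RR).
  apply: continuous_measurable_fun => y.
  apply: (@continuous_comp _ _ _ (fun y : R => pi *+ 2 * y) (fun z : R => a * sin z)).
    exact: mulrl_continuous.
  apply: (@continuous_comp _ _ _ (@sin R) ( *%R a)); first exact: continuous_sin.
  exact: mulrl_continuous.
apply: measurable_fun_pair; last exact: measurable_snd.
apply: measurable_fun_pair => //.
apply: (@measurable_funD _ R3 R _ (fun u => u.1.1)) => //.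
exact: measurableT_comp msin m12.
Qed.

(** The lifted set is sliced along the first coordinate. Each slice [T] is 1-periodic and the shear
    translates it by a constant [c] depending on [y], so slicewise invariance integrates to the
    claim. *)
Lemma torus_shear_volume_preserving a :
  volume_preserving (torus_shear a : torus R -> torus R).
Proof.
move=> B mB; set S := [set u : R3 | B (torus_pi (col3 u))] in mB *.
have preS : [set u : R3 | (torus_shear a @^-1` B) (torus_pi (col3 u))] =
    shear3 a @^-1` S.
  by apply/seteqP; split => u; rewrite /S /= col3_shear3 -shear_is_lift.
have mS' : measurable (shear3 a @^-1` S).
  by rewrite -[X in measurable X]setTI; exact: measurable_shear3.
split; first by rewrite /torus_measurable preS.
have mC : measurable (@unit_cube R) by do 2 ?apply: measurableX.
rewrite /torus_volume preS -/S !lebesgue3E; [|exact: measurableI..].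
apply: eq_integral => z _; apply: eq_integral => y _.
pose T : set RR := ysection (ysection S z) y.
have mT : measurable T by do 2 apply: measurable_ysection.
have TE x : T x <-> B (torus_pi (col3 ((x, y), z))).
  by rewrite /T /ysection /= !inE /= !inE.
have perT (k : int) x : T (x + k%:~R : R) <-> T x.
  rewrite !TE.
  suff -> : torus_pi (col3 (((x + k%:~R : R) : RR, y), z)) =
            torus_pi (col3 ((x, y), z)) by [].
  apply/eqP/torus_piP => i; rewrite !mxE.
  case: i => -[|[|[|//]]] /= _; rewrite ?subrr ?rpred0//.
  by rewrite addrAC subrr add0r intr_int.
pose c := a * sin (pi *+ 2 * (y : R)).
(* The cube's condition on [y] and [z] does not involve the slice variable, so it cuts out either
   nothing or the whole line. *)
pose D : set RR := [set _ | `[0%R, 1%R[%classic z /\ `[0%R, 1%R[%classic y].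
have sec (X : set R3) (X' : set RR) : (forall x, X ((x, y), z) <-> X' x) ->
    ysection (ysection (@unit_cube R `&` X) z) y = D `&` (`[0, 1[%classic `&` X').
  move=> XX'; apply/seteqP; split => x.
    by rewrite /ysection /= !inE /= !inE => -[[[? ?] ?] /XX' ?]; do !split.
  by rewrite /ysection /= !inE /= !inE => -[[? ?] [? /XX' ?]]; do !split.
rewrite (sec S T) => [|x]; last by rewrite TE.
rewrite (sec _ (translation c @^-1` T)) => [|x]; last by rewrite /= TE.
have [D0|DT] : D = set0 \/ D = setT.
  by have [zy|zy] := pselect (`[0%R, 1%R[%classic z /\ `[0%R, 1%R[%classic y);
    [right|left]; apply/seteqP; split.
- by rewrite D0 !set0I.
- by rewrite DT !setTI; exact: lebesgue_cell_translation.
Qed.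

End shear_volume.

(** * The four sign matrices and the singular values of their mean *)

Section sign_matrices.
Variable R : realType.

Lemma diag3_SO (a b c : R) : a ^+ 2 = 1 -> b ^+ 2 = 1 -> c ^+ 2 = 1 ->
  a * b * c = 1 -> in_SO (diag3 a b c).
Proof.
move=> a2 b2 c2 abc; split; last first.
  by rewrite /diag3 det_diag !big_ord_recl big_ord0 !mxE /= mulr1 mulrA.
rewrite /diag3 tr_diag_mx mulmx_diag; apply/matrixP => i j; rewrite !mxE.
by case: i => -[|[|[|//]]] i3 /=; rewrite -expr2 ?a2 ?b2 ?c2.
Qed.

Lemma Rmx_SO (j : 'I_4) : in_SO (@Rmx R j).
Proof.
by case: j => -[|[|[|[|//]]]] j4; apply: diag3_SO => /=; ring.
Qed.

Lemma average_Rmx : average_mx (@Rmx R) = 0.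
Proof.
rewrite /average_mx; set M := \sum_j _; suff -> : M = 0 by rewrite scaler0.
rewrite /M !big_ord_recl big_ord0; apply/matrixP => i j; rewrite !mxE.
case: (i == j); rewrite ?mulr0n ?addr0//.
by case: i => -[|[|[|//]]] i3 /=; rewrite !mulr1n; ring.
Qed.

Lemma smallest_singular_value0 n :
  smallest_singular_value (0 : 'M[R]_n.+1) = 0.
Proof.
rewrite /smallest_singular_value mulmx0 [X in inf X](_ : _ = [set 0]) ?inf1//.
apply/seteqP; split => [s [_ /eigenvalueP[v]]|_ ->].
  rewrite mulmx0 => /esym/eqP; rewrite scaler_eq0 sqrf_eq0 => /orP[/eqP //|].
  by move=> ->.
(* Any nonzero row vector is an eigenvector of the zero matrix; the positive dimension makes the
   all-ones row nonzero. *)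
split => //; apply/eigenvalueP; exists (const_mx 1).
  by rewrite mulmx0 expr0n scale0r.
by apply/eqP => /rowP/(_ 0)/eqP; rewrite !mxE oner_eq0.
Qed.

End sign_matrices.

(** * The fair choice between two opposite shears *)

Section two_shears.
Variable R : realType.
Implicit Types (a : R) (w : bool).

Definition random_shear a w : torus R -> torus R :=
  torus_shear (if w then a else - a).

Let half01 : 0 <= (2^-1 : R) <= 1.
Proof. by lra. Qed.

Local Notation P := (bernoulli_prob (2^-1 : R)).

Lemma random_shear_two_valued (n : nat) :
  two_valued P (random_shear (n%:R + 4^-1)).
Proof.
set a := n%:R + 4^-1.
have neq : random_shear a true <> random_shear a false.
  (* At this point the sine equals 1, so the lifted images differ by [2 * a = 2 * n + 1/2] in
     coordinate 0. The offset 1/4 in [a] keeps this from being an integer, also for [n = 0]. *)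
  pose q : 'cV[R]_3 := const_mx 4^-1.
  move/(congr1 (@^~ (torus_pi q))); rewrite /random_shear -!shear_is_lift.
  move/eqP/torus_piP/(_ 0).
  have -> : shear a q 0 0 - shear (- a) q 0 0 = (2 * n)%:R + 2^-1.
    have -> : (2 * n)%:R = 2 * n%:R :> R by rewrite natrM.
    rewrite !mxE /phase mxE; have -> : pi *+ 2 * 4^-1 = pi / 2 :> R by lra.
    by rewrite sin_pihalf /a eqxx /=; lra.
  move/rpredB/(_ (natr_int R (2 * n))); rewrite addrAC subrr add0r.
  by move/int_norm_lt1; rewrite ger0_norm; lra.
have pre w : random_shear a @^-1` [set random_shear a w] = [set w].
  apply/seteqP; split => [w' /= ww'|_ -> //].
  by case: w w' ww' => -[] // /esym //; rewrite /= => /esym.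
exists (random_shear a true), (random_shear a false); split => //.
- apply/seteqP; split => [_ [[] _ <-]|_ [] ->];
    [by left|by right|by exists true|by exists false].
- rewrite !pre; split => //=; rewrite !bernoulli_probE// !diracE /=
    !in_set1 /= /unstable.onem -!EFinM -!EFinD lte_fin; lra.
Qed.

(** The integral is the difference of those of the positive and negative parts, each a two-term sum;
    [posneg] recombines them. *)
Lemma expectation_fair_coin (f : bool -> R) :
  ('E_P[f] = (2^-1 * (f true + f false))%:E)%E.
Proof.
rewrite unlock integralE !integral_bernoulli_prob// !funeposE !funenegE.
rewrite -!EFinN -!EFin_max -!EFinM -!EFinD /unstable.onem; congr (_%:E).
have posneg (x : R) : x = Num.max x 0 - Num.max (- x) 0.
  by rewrite /Num.max oppr_lt0; case: ltgtP => // [| |->]; rewrite ?oppr0; lra.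
by rewrite [in RHS](posneg (f true)) [in RHS](posneg (f false)); lra.
Qed.

Lemma mean_grad_random_shear a :
  (fun p => mean_mx P (fun w => grad (random_shear a w) p)) = (fun=> 1%:M).
Proof.
apply/funext => p; apply/matrixP => i j.
by rewrite mxE expectation_fair_coin /random_shear !grad_shear !mxE /=; lra.
Qed.

Lemma Calpha_grad_shear_ge (alpha a : R) :
  (`|a|%:E <= Calpha_norm alpha (grad (torus_shear a)))%E.
Proof.
apply: le_trans (entry_le_Calpha_norm alpha _ (torus_pi 0) 0 1).
(* The canonical representative of the origin need not be 0, but its coordinates are integers, so
   the cosine is still 1. *)
have zero_phase : cos (phase (repr (torus_pi (0 : 'cV[R]_3)))) = 1.
  have [_ ->] := phase_int (repr_torus_pi (0 : 'cV[R]_3) 1).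
  by rewrite /phase mxE mulr0 cos0.
rewrite lee_fin grad_shear zero_phase !mxE /= add0r !mulr1 normrM ler_peMr//.
have := pi_ge2 R; rewrite -(mulr_natr pi) => pi2; rewrite ger0_norm; lra.
Qed.

End two_shears.

Theorem proposition6p1 (R : realType) (alpha : R)
    (halpha : 0 < alpha < 1) :
  (exists c : R, 0 < c /\
    forall N : nat,
    exists (d : measure_display) (W : measurableType d) (P : probability W R)
           (A : W -> torus R -> torus R),
      [/\ two_valued P A,
          forall w, [/\ torus_diffeo (A w), volume_preserving (A w) &
                        isotopic_to_id (A w)],
          Calpha_norm alpha (fun p => mean_mx P (fun w => grad (A w) p)) = 1%E &
          ((c * N%:R)%:E <= \int[P]_w Calpha_norm alpha (grad (A w)))%E])
  /\
  [/\ forall j : 'I_4, in_SO (@Rmx R j),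
      average_mx (@Rmx R) = 0 &
      ~ (exists e : R, 0 < e /\
           forall (m : nat) (M : 'I_m.+1 -> 'M[R]_3),
             (forall j, \det (M j) = 1) ->
             e <= smallest_singular_value (average_mx M))].
Proof.
split; last first.
  split; [exact: Rmx_SO|exact: average_Rmx|move=> [e [e0 emin]]].
  (* The index type is ['I_m.+1], so [m = 3] gives the four sign matrices, whose zero mean forces
     [e <= 0]. *)
  have := emin 3 (@Rmx R) (fun j => (Rmx_SO R j).2).
  by rewrite average_Rmx smallest_singular_value0 leNgt e0.
(* The constant 1 suffices: both gradients have norm at least [N + 1/4]. *)
exists 1; split=> // N.
exists _, bool, (bernoulli_prob 2^-1), (random_shear (N%:R + 4^-1)); split.
- exact: random_shear_two_valued.
- move=> w; split; first exact: torus_shear_diffeo.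
    exact: torus_shear_volume_preserving.
  exact: torus_shear_isotopic.
- by rewrite mean_grad_random_shear Calpha_norm_id.
- rewrite integral_bernoulli_prob; [|lra|by move=> w; exact: Calpha_norm_ge0].
  set a := N%:R + 4^-1 : R.
  (* A lower bound common to both outcomes passes to their equal-weight mean, here in the extended
     reals. *)
  have coin (r s : \bar R) : (`|a|%:E <= r -> `|a|%:E <= s ->
      (`|a|)%:E <= (2^-1)%:E * r + (unstable.onem 2^-1 : R)%:E * s)%E.
    move=> ar a_s; rewrite [leLHS](_ : _ =
      (2^-1)%:E * (`|a|)%:E + (unstable.onem 2^-1 : R)%:E * (`|a|)%:E)%E.
      by apply: leeD; apply: lee_wpmul2l; rewrite ?lee_fin // /unstable.onem; lra.
    by rewrite -!EFinM -EFinD /unstable.onem; congr (_%:E); lra.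
  apply: le_trans (coin _ _ _ _).
  - by rewrite lee_fin mul1r ger0_norm /a; have := ler0n R N; lra.
  - exact: Calpha_grad_shear_ge.
  - by rewrite -normrN; exact: Calpha_grad_shear_ge.
Qed.
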